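(* Let $(\sigma_n)_{n\ge 1}$ be a sequence of positive real numbers, and consider the time-dependent Pólya urn with reinforcement sequence $(\sigma_n)$, with $T_0$ initial white balls and $\tau_0$ initial balls in total, where $\tau_n=\tau_0+\sum_{i=1}^n\sigma_i$. Let $\mathcal{M}$ and $\mathcal{D}$ be the monopoly and domination events of this urn. Suppose $$\sum_{n=1}^{\infty}\frac{1}{\tau_n}<\infty.$$ Then $0<\mathbb{P}(\mathcal{M})\le \mathbb{P}(\mathcal{D})$. If, additionally, $$\liminf_{n\to\infty}\frac{\sigma_n}{\tau_n}>0,$$ then $\mathbb{P}(\mathcal{M})=\mathbb{P}(\mathcal{D})=1$.
   Context: Time-dependent Pólya urn: let $(\sigma_n)_{n\ge1}$ be a deterministic sequence of positive real numbers (not necessarily integers), let $\tau_0$ (initial total number of balls) and $T_0$ (initial number of white balls) be deterministic integers with $1\le T_0\le \tau_0-1$ (at least one white and one black ball initially), and set $\tau_n=\tau_0+\sum_{i=1}^n\sigma_i$ for $n\ge 0$. The random processes $(I_n)_{n\ge1}$, $(T_n)_{n\ge 0}$, $(\Theta_n)_{n\ge 0}$ are defined recursively on a probability space by $\Theta_n=T_n/\tau_n$ and $T_{n+1}=T_n+\sigma_{n+1}I_{n+1}$, where, conditionally on $\mathcal{F}_n=\sigma(I_1,\dots,I_n)$ (the generated $\sigma$-algebra), $I_{n+1}$ is a Bernoulli random variable with parameter $\Theta_n$, i.e. $I_{n+1}\in\{0,1\}$ and $\mathbb{P}(I_{n+1}=1\mid\mathcal{F}_n)=\Theta_n$. The process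 $(\Theta_n)$ is a bounded martingale and hence converges almost surely to a random variable denoted $\Theta$. Domination event: $\mathcal{D}=\{\Theta=0\}\cup\{\Theta=1\}$. Monopoly event: $\mathcal{M}=\{I_n=0 \text{ for all sufficiently large } n\}\cup\{I_n=1\text{ for all sufficiently large } n\}$. *)

(* Defs.v *)
From HB Require Import structures.
From mathcomp Require Import all_boot all_order all_algebra.
From mathcomp Require Import all_classical all_reals all_analysis.

Set Implicit Arguments.
Unset Strict Implicit.
Unset Printing Implicit Defensive.

Import Order.TTheory GRing.Theory Num.Theory.
Import numFieldNormedType.Exports.

Local Open Scope classical_set_scope.
Local Open Scope ring_scope.

(* The sequences sigma and I start at index 1: they are functions on nat
   whose value at 0 is never used. *)

Definition tau (R : realType) (sigma : nat -> R) (tau0 n : nat) : R :=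
  tau0%:R + \sum_(1 <= i < n.+1) sigma i.

Fixpoint white (R : realType) (Omega : Type) (sigma : nat -> R) (T0 : nat)
    (I : nat -> Omega -> bool) (n : nat) (w : Omega) : R :=
  if n is m.+1 then white sigma T0 I m w + sigma m.+1 * (I m.+1 w)%:R
  else T0%:R.

Definition white_prop (R : realType) (Omega : Type) (sigma : nat -> R)
    (tau0 T0 : nat) (I : nat -> Omega -> bool) (n : nat) (w : Omega) : R :=
  white sigma T0 I n w / tau sigma tau0 n.

(* The sigma-algebra generated by I 1, ..., I n. *)
Definition natural_filtration (Omega : Type) (I : nat -> Omega -> bool)
    (n : nat) : set (set Omega) :=
  <<s \bigcup_(i in [set i | (1 <= i <= n)%N])
        preimage_set_system setT (I i) measurable >>.

(* Y is a version of the conditional probability P(E | F). *)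
Definition is_cond_prob d (Omega : measurableType d) (R : realType)
    (P : probability Omega R) (F : set (set Omega)) (E : set Omega)
    (Y : Omega -> R) : Prop :=
  [/\ preimage_set_system setT Y measurable `<=` F,
      P.-integrable setT (EFin \o Y)
    & forall A, F A -> (P (A `&` E) = \int[P]_(w in A) (Y w)%:E)%E].

(* The reinforcement indicators of the urn; being boolean, I n.+1 is
   conditionally Bernoulli as soon as the conditional probability of the event
   {I n.+1 = 1} is the current proportion of white balls. *)
Definition polya_urn d (Omega : measurableType d) (R : realType)
    (P : probability Omega R) (sigma : nat -> R) (tau0 T0 : nat)
    (I : nat -> {RV P >-> bool}) : Prop :=
  forall n, is_cond_prob P (natural_filtration I n)
    [set w | I n.+1 w = true] (white_prop sigma tau0 T0 I n).

Definition domination (R : realType) (Omega : Type) (Theta : Omega -> R) :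
    set Omega :=
  [set w | Theta w = 0] `|` [set w | Theta w = 1].

Definition monopoly (Omega : Type) (I : nat -> Omega -> bool) : set Omega :=
  [set w | \forall n \near \oo, I n w = false] `|`
  [set w | \forall n \near \oo, I n w = true].

(* Main.v *)
(** The colours of the first [n] draws determine [Theta_n], so the probability of
    a finite word of draws is the product of the successive proportions.
    - The word of [n] black draws has probability [\prod_(i < n) (1 - T0 / tau_i)],
      which stays away from 0 when [\sum 1 / tau_i] converges. If the draws are
      eventually constant, then [T_n] or [tau_n - T_n] is eventually constant, and
      [Theta_n] tends to 0 or 1 because [tau_n] tends to infinity.
    - With [r_n = sigma_n / tau_n], the expectation of [Theta_n (1 - Theta_n)] is
      multiplied by [1 - r_(n+1)^2] at each step, and the next two draws differ
      with probability at most [2 Theta_n (1 - Theta_n)] given the past. If [r_n]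
      is bounded away from 0, these probabilities are summable, and by
      Borel-Cantelli the draws change colour finitely often almost surely. *)

Require Import Defs.
From HB Require Import structures.
From mathcomp Require Import all_boot all_order all_algebra.
From mathcomp Require Import all_classical all_reals all_analysis.
From mathcomp Require Import ring lra.
Set Implicit Arguments.
Unset Strict Implicit.
Unset Printing Implicit Defensive.
Import Order.TTheory GRing.Theory Num.Theory.
Import numFieldNormedType.Exports.
Local Open Scope classical_set_scope.
Local Open Scope ring_scope.

(** * Real series, products and lower limits *)

(** Weierstrass's product inequality, by induction on [n]. The upper bound is carried along because
    the step [p * (1 - a) >= p - a] needs [p <= 1]. *)
Lemma prod_onem_ge_onem_sum (R : realDomainType) (a : nat -> R) (m n : nat) :
  (forall i, 0 <= a i <= 1) ->
  1 - \sum_(m <= i < n) a i <= \prod_(m <= i < n) (1 - a i) <= 1.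
Proof.
move=> a01; case: (leqP m n) => [|/ltnW nm]; last first.
  by rewrite !big_geq// subr0 lexx.
elim: n => [|n IHn]; first by rewrite leqn0 => /eqP ->; rewrite !big_geq// subr0 lexx.
rewrite leq_eqVlt ltnS => /orP[/eqP ->|mn].
  by rewrite !big_geq// subr0 lexx.
rewrite !big_nat_recr//=.
have s0 : 0 <= \sum_(m <= i < n) a i by apply: sumr_ge0 => i _; case/andP: (a01 i).
have p0 : 0 <= \prod_(m <= i < n) (1 - a i).
  by apply: prodr_ge0 => i _; rewrite subr_ge0; case/andP: (a01 i).
move: (a01 n) (IHn mn) => /andP[? ?] /andP[? ?]; apply/andP; split; nra.
Qed.

(** Past some [N] the sums of [a] stay below 1/2, so by the previous inequality the product from [N]
    on stays above 1/2; the finite head is positive since each [a i < 1]. *)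
Lemma prod_onem_bounded_below (R : realType) (a : nat -> R) :
  (forall i, 0 <= a i < 1) -> (\sum_(0 <= i <oo) (a i)%:E < +oo)%E ->
  exists2 e : R, 0 < e & forall n, e <= \prod_(0 <= i < n) (1 - a i).
Proof.
move=> a01 suma.
have a0 i : 0 <= a i by case/andP: (a01 i).
have a1 i : a i < 1 by case/andP: (a01 i).
have ale i : 0 <= a i <= 1 by rewrite a0 ltW.
have tail0 := @nneseries_tail_cvg _ _ xpredT suma (fun i _ => a0 i).
have half0 : (0 < (2^-1 : R)%:E)%E by rewrite lte_fin invr_gt0.
have [N _ tailN] : \forall N \near \oo, (\sum_(N <= i <oo) (a i)%:E < (2^-1)%:E)%E.
  exact: (tail0 _ (open_ereal_lt' half0)).
have Nhalf n : \sum_(N <= i < n) a i <= 2^-1.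
  rewrite -lee_fin -sumEFin; apply: le_trans (ltW (tailN N (leqnn N))).
  by apply: nneseries_lim_ge => i _ _; rewrite lee_fin.
have pN : 0 < \prod_(0 <= i < N) (1 - a i).
  by apply: prodr_gt0 => i _; rewrite subr_gt0.
exists (\prod_(0 <= i < N) (1 - a i) / 2); first by rewrite divr_gt0.
move=> n; have [nN|/ltnW Nn] := leqP n N.
  have /andP[_ p1] := @prod_onem_ge_onem_sum _ a n N ale.
  have pn : 0 <= \prod_(0 <= i < n) (1 - a i).
    by apply: prodr_ge0 => i _; rewrite subr_ge0 ltW.
  rewrite (big_cat_nat (leq0n _) nN)//=; nra.
have /andP[p1 _] := @prod_onem_ge_onem_sum _ a N n ale.
have := Nhalf n; rewrite (big_cat_nat (leq0n _) Nn)//= => ?; nra.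
Qed.

(** The lower limit is the limit of the tail infima. If it is positive then so is one of these
    infima, and that infimum serves as [c]. *)
Lemma limn_einf_gt0_near (R : realType) (u : nat -> R) :
  (0 < limn_einf (fun n => (u n)%:E))%E ->
  exists2 c : R, 0 < c & \forall n \near \oo, c <= u n.
Proof.
rewrite limn_einf_lim => lim0.
have [N] : exists N, (0 < einfs (fun n => (u n)%:E) N)%E.
  apply: contrapT => /forallNP einf0; move: lim0; apply/negP; rewrite -leNgt.
  apply: lime_le; first exact: is_cvg_einfs.
  by apply: nearW => n; rewrite leNgt; apply/negP/einf0.
have leu n : (N <= n)%N -> (einfs (fun n => (u n)%:E) N <= (u n)%:E)%E.
  by move=> Nn; apply: ereal_inf_lbound; exists n.
case E : (einfs _ N) leu => [c| |] leu; rewrite ?lte_fin //= => c0.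
- by exists c => //; exists N => // n /= /leu; rewrite lee_fin.
(* An infimum equal to [+oo] would lie below the real number [u N]. *)
- by have := leu N (leqnn N).
Qed.

Lemma prod_le_expr (R : realFieldType) (f : nat -> R) (q : R) :
  0 < q -> (forall i, 0 <= f i <= 1) -> (\forall i \near \oo, f i <= q) -> q <= 1 ->
  exists2 K : R, 0 <= K & forall n, \prod_(0 <= i < n) f i <= K * q ^+ n.
Proof.
move=> q0 f01 [N _ fq] q1.
have f0 i : 0 <= f i by case/andP: (f01 i).
have f1 i : f i <= 1 by case/andP: (f01 i).
(* The first [N] factors are only known to be at most 1; [q ^- N] makes up for them. *)
exists (q ^- N); first by rewrite invr_ge0 exprn_ge0// ltW.
move=> n; rewrite mulrC ler_pdivlMr ?exprn_gt0//.
have [nN|/ltnW Nn] := leqP n N.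
  apply: (@le_trans _ _ (q ^+ N)).
    rewrite ler_piMl ?exprn_ge0//; first exact: ltW.
    exact: prodr_ile1.
  by apply: ler_wiXn2l => //; exact: ltW.
rewrite -(subnKC Nn); elim: (n - N)%N => [|k IHk].
  rewrite addn0 ler_piMl ?exprn_ge0//; first exact: ltW.
  exact: prodr_ile1.
rewrite addnS big_nat_recr//= exprSr mulrAC ler_pM//.
  by rewrite mulr_ge0 ?exprn_ge0 ?(ltW q0)// prodr_ge0.
by apply: fq; rewrite /= leq_addr.
Qed.

Lemma cvg0_nneseries_lty (R : realType) (u : nat -> R) : (forall n, 0 <= u n) ->
  (\sum_(0 <= n <oo) (u n)%:E < +oo)%E -> u n @[n --> \oo] --> 0.
Proof.
move=> u0 sumu; apply/cvgrPdist_lt => e e0.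
have eE : (0 < e%:E)%E by rewrite lte_fin.
have tail0 := @nneseries_tail_cvg _ _ xpredT sumu (fun i _ => u0 i).
have [N _ tailN] := tail0 _ (open_ereal_lt' eE).
exists N => // n /tailN; rewrite /= sub0r normrN ger0_norm// -lte_fin.
apply: le_lt_trans; have := @nneseries_lim_ge _ (EFin \o u) xpredT n n.+1.
by rewrite big_nat1; apply => i _ _; rewrite lee_fin.
Qed.

Lemma nneseries_geometric_lty (R : realType) (K q : R) : 0 <= K -> 0 < q < 1 ->
  (\sum_(0 <= n <oo) (K * q ^+ n)%:E < +oo)%E.
Proof.
move=> K0 /andP[q0 q1]; apply: (@le_lt_trans _ _ (K / (1 - q))%:E); last exact: ltry.
apply: lime_le.
  by apply: is_cvg_nneseries => n _ _; rewrite lee_fin mulr_ge0// exprn_ge0// ltW.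
apply: nearW => n; rewrite sumEFin lee_fin.
by apply: (@geometric_le_lim _ n) => //; rewrite ger0_norm// ltW.
Qed.

(** * Deterministic urn along a word of draws *)

(* Words of draws are listed backwards, the latest draw first, so that adding a
   draw is a [cons]. *)
Fixpoint history (Omega : Type) (I : nat -> Omega -> bool) (n : nat) (w : Omega) :
    seq bool :=
  if n is m.+1 then I m.+1 w :: history I m w else [::].

Definition cylinder (Omega : Type) (I : nat -> Omega -> bool) (s : seq bool) :
    set Omega :=
  [set w | history I (size s) w = s].

(** Deterministic counterpart of [white]. In the [cons] case [s] is still the whole word, so the
    latest draw gets the index [(size t).+1]. *)
Fixpoint word_white (R : realType) (sigma : nat -> R) (T0 : nat) (s : seq bool) : R :=
  if s is b :: t then word_white sigma T0 t + sigma (size s) * b%:R else T0%:R.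

Definition word_prop (R : realType) (sigma : nat -> R) (tau0 T0 : nat)
    (s : seq bool) : R :=
  word_white sigma T0 s / tau sigma tau0 (size s).

Section Words.
Variables (R : realType) (sigma : nat -> R) (tau0 T0 : nat).
Hypothesis sigma_gt0 : forall n, (1 <= n)%N -> 0 < sigma n.
Hypothesis T0_bounds : (1 <= T0 <= tau0 - 1)%N.

Local Notation tau := (tau sigma tau0).
Local Notation word_prop := (word_prop sigma tau0 T0).

Lemma tauS n : tau n.+1 = tau n + sigma n.+1.
Proof. by rewrite /Defs.tau big_nat_recr//= addrA. Qed.

Lemma T0_lt_tau n : T0%:R < tau n.
Proof.
elim: n => [|n /lt_trans]; last by rewrite tauS; apply; rewrite ltrDl sigma_gt0.
rewrite /Defs.tau big_geq// addr0 ltr_nat.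
case/andP: T0_bounds => T01 T0tau.
by rewrite (leq_ltn_trans T0tau)// ltn_subrL /= (leq_trans T01)// (leq_trans T0tau)// leq_subr.
Qed.

Lemma tau_gt0 n : 0 < tau n.
Proof. exact: le_lt_trans (ler0n _ _) (T0_lt_tau n). Qed.

Lemma reinforcement_ratio_bounds n : 0 <= sigma n.+1 / tau n.+1 <= 1.
Proof.
have t0 := tau_gt0 n; have s0 := @sigma_gt0 n.+1 isT.
have st : sigma n.+1 <= tau n.+1 by rewrite tauS lerDr ltW.
have t1 := tau_gt0 n.+1.
by rewrite divr_ge0 ?(ltW t1) ?(ltW s0)//= ler_pdivrMr ?mul1r.
Qed.

Lemma nneseries_inv_tau_lty : (\sum_(1 <= n <oo) ((tau n)^-1)%:E < +oo)%E ->
  (\sum_(0 <= n <oo) ((tau n)^-1)%:E < +oo)%E.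
Proof.
move=> sum_tau; rewrite nneseries_recl ?lte_add_pinfty ?ltry// => i _.
by rewrite lee_fin invr_ge0 ltW// tau_gt0.
Qed.

Lemma word_white_bounds s : 0 <= word_white sigma T0 s <= tau (size s).
Proof.
elim: s => [|b s /andP[IH0 IH1]] /=; first by rewrite ler0n ltW// T0_lt_tau.
have s0 := @sigma_gt0 (size s).+1 isT.
rewrite tauS; case: b; rewrite ?mulr1 ?mulr0 ?addr0; apply/andP; split; lra.
Qed.

Lemma word_prop_bounds s : 0 <= word_prop s <= 1.
Proof.
have /andP[w0 w1] := word_white_bounds s.
have t0 := tau_gt0 (size s).
by rewrite /word_prop divr_ge0 ?(ltW t0)//= ler_pdivrMr ?mul1r.
Qed.

(** The new proportion is the convex combination of the old one and the drawn colour with weight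
    [r = sigma / tau]. In this form averages over the next draw become polynomial identities in [p]
    and [r]. *)
Lemma word_prop_cons b s : word_prop (b :: s) =
  word_prop s + sigma (size s).+1 / tau (size s).+1 * (b%:R - word_prop s).
Proof.
have t0 := tau_gt0 (size s); have s0 := @sigma_gt0 (size s).+1 isT.
rewrite /word_prop /= tauS; field.
by rewrite !gt_eqF// addr_gt0.
Qed.

Lemma word_prop_nseq_false n : word_prop (nseq n false) = T0%:R / tau n.
Proof.
rewrite /word_prop size_nseq; congr (_ / _).
by elim: n => //= n ->; rewrite mulr0 addr0.
Qed.

End Words.

Lemma white_history (R : realType) (sigma : nat -> R) (T0 : nat) (Omega : Type)
    (I : nat -> Omega -> bool) n w :
  white sigma T0 I n w = word_white sigma T0 (history I n w).
Proof.
have sz m : size (history I m w) = m by elim: m => //= m ->.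
by elim: n => //= n ->; rewrite sz.
Qed.

(** * Probabilities of words of draws *)

Section Urn.
Variables (d : measure_display) (Omega : measurableType d).
Variables (R : realType) (P : probability Omega R).
Variables (sigma : nat -> R) (tau0 T0 : nat) (I : nat -> {RV P >-> bool}).
Hypothesis sigma_gt0 : forall n, (1 <= n)%N -> 0 < sigma n.
Hypothesis T0_bounds : (1 <= T0 <= tau0 - 1)%N.
Hypothesis urnI : polya_urn sigma tau0 T0 I.

Local Notation cyl := (cylinder I).
Local Notation word_prop := (word_prop sigma tau0 T0).

Lemma white_prop_cylinder s w : cyl s w ->
  white_prop sigma tau0 T0 I (size s) w = word_prop s.
Proof. by move=> sw; rewrite /white_prop white_history; congr (word_white _ _ _ / _). Qed.

Lemma measurable_draw n b : measurable [set w | I n w = b].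
Proof. exact: (measurable_funPTI (I n) (Y := [set b])). Qed.

Lemma cylinder_nil : cyl [::] = setT.
Proof. by apply/seteqP. Qed.

Lemma cylinder_cons b s : cyl (b :: s) = cyl s `&` [set w | I (size s).+1 w = b].
Proof.
apply/seteqP; split => w; first by case=> Ib hs; split.
by case=> hs Ib; rewrite /cylinder /=; congr (_ :: _).
Qed.

Lemma measurable_cylinder s : measurable (cyl s).
Proof.
elim: s => [|b s IHs]; first by rewrite cylinder_nil.
by rewrite cylinder_cons; apply: measurableI => //; exact: measurable_draw.
Qed.

Lemma natural_filtration_cylinder s n : (size s <= n)%N ->
  natural_filtration I n (cyl s).
Proof.
pose G := \bigcup_(i in [set i | (1 <= i <= n)%N])
  preimage_set_system setT (I i) measurable.
rewrite /natural_filtration -/G => sn.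
(* Membership in the generated sigma-algebra is read as measurability, so that closure under
   intersection applies. *)
change (measurable (cyl s : set (g_sigma_algebraType G))).
elim: s sn => [|b s IHs] sn.
  by rewrite cylinder_nil; exact: measurableT.
rewrite cylinder_cons; apply: measurableI; first by apply: IHs; exact: ltnW.
apply: sub_sigma_algebra; exists (size s).+1; first by [].
by exists [set b] => //; rewrite setTI.
Qed.

Definition word_prob (s : seq bool) : R := fine (P (cyl s)).

Lemma word_probE s : P (cyl s) = (word_prob s)%:E.
Proof. by rewrite fineK// fin_num_measure//; exact: measurable_cylinder. Qed.

Lemma word_prob_ge0 s : 0 <= word_prob s.
Proof. exact: fine_ge0. Qed.

Lemma word_prob_nil : word_prob [::] = 1.
Proof. by rewrite /word_prob cylinder_nil probability_setT. Qed.

(** The cylinder of [s] belongs to the past and [white_prop] is constant on it, so the integral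
    defining the conditional probability is that constant times [P (cyl s)]. *)
Lemma word_prob_true s : word_prob (true :: s) = word_prop s * word_prob s.
Proof.
have [_ _ /(_ _ (@natural_filtration_cylinder s _ (leqnn _)))] := urnI (size s).
rewrite -cylinder_cons word_probE.
under eq_integral => w /set_mem sw do rewrite (white_prop_cylinder sw).
rewrite integral_cst; last exact: measurable_cylinder.
by move=> pE; apply: EFin_inj; rewrite pE (EFinM (word_prop s)) -word_probE.
Qed.

Lemma measure_cylinder_split s A : measurable A ->
  P (cyl s `&` A) = (P (cyl (true :: s) `&` A) + P (cyl (false :: s) `&` A))%E.
Proof.
move=> mA; rewrite -measureU.
- congr (P _); apply/seteqP; split => w; rewrite !cylinder_cons /=.
    by case=> sw Aw; case: (I _ w); [left|right].
  by case=> [[[sw _] Aw]|[[sw _] Aw]].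
- by apply: measurableI => //; exact: measurable_cylinder.
- by apply: measurableI => //; exact: measurable_cylinder.
- apply/seteqP; split => w //; rewrite !cylinder_cons /=.
  by case=> [[[_ ->] _] [[]]].
Qed.

Lemma word_prob_false s : word_prob (false :: s) = (1 - word_prop s) * word_prob s.
Proof.
have := measure_cylinder_split s measurableT.
rewrite !setIT !word_probE -EFinD word_prob_true => -[] ps; lra.
Qed.

Lemma word_prob_nseq_false n :
  word_prob (nseq n false) = \prod_(0 <= i < n) (1 - T0%:R / tau sigma tau0 i).
Proof.
elim: n => [|n IHn]; first by rewrite word_prob_nil big_geq.
by rewrite [nseq _ _]/= word_prob_false IHn word_prop_nseq_false big_nat_recr//= mulrC.
Qed.

(** * Positive probability of monopoly *)

Lemma monopolyE : monopoly I =
  (\bigcup_n \bigcap_(k in [set k | (n <= k)%N]) [set w | I k w = false]) `|`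
  (\bigcup_n \bigcap_(k in [set k | (n <= k)%N]) [set w | I k w = true]).
Proof.
by rewrite /monopoly; congr (_ `|` _); apply/seteqP; split => w [N ? Nw]; exists N.
Qed.

Lemma measurable_monopoly : measurable (monopoly I).
Proof.
rewrite monopolyE; apply: measurableU; apply: bigcup_measurable => n _;
  apply: bigcap_measurableType => k _; exact: measurable_draw.
Qed.

(** The event that all draws are black is a decreasing intersection of cylinders. By continuity from
    above its probability is the limit of products bounded below by [e > 0]. *)
Lemma monopoly_gt0 : (\sum_(1 <= n <oo) ((tau sigma tau0 n)^-1)%:E < +oo)%E ->
  (0 < P (monopoly I))%E.
Proof.
move=> sum_tau.
have a01 i : 0 <= T0%:R / tau sigma tau0 i < 1.
  have t0 := tau_gt0 sigma_gt0 T0_bounds i.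
  by rewrite divr_ge0 ?ler0n ?(ltW t0)//= ltr_pdivrMr// mul1r T0_lt_tau.
have [|e e0 le_prod] := prod_onem_bounded_below a01.
  under eq_eseriesr do rewrite EFinM.
  rewrite nneseriesZl => [|i _]; last first.
    by rewrite lee_fin invr_ge0 ltW//; exact: tau_gt0 sigma_gt0 T0_bounds i.
  rewrite lte_mul_pinfty ?lee_fin//.
  exact: nneseries_inv_tau_lty sigma_gt0 T0_bounds sum_tau.
pose F n := cyl (nseq n false).
have mF n : measurable (F n) by exact: measurable_cylinder.
have mcapF : measurable (\bigcap_n F n) by exact: bigcapT_measurable.
have F_noninc : {homo F : n m / (n <= m)%N >-> (m <= n)%O}.
  apply/nonincreasing_seqP => n; rewrite /F [nseq n.+1 _]/= cylinder_cons.
  by apply/subsetPset; exact: subIsetl.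
have P0 : (P (F 0%N) < +oo)%E by rewrite (le_lt_trans (probability_le1 _ _)) ?ltry.
have cvgF := nonincreasing_cvg_mu P0 mF mcapF F_noninc.
apply: (@lt_le_trans _ _ (P (\bigcap_n F n))); last first.
  apply: le_measure; rewrite ?inE//; first exact: measurable_monopoly.
  (* Constancy starts at 1 because cylinders say nothing about [I 0]. *)
  move=> w Fw; left; exists 1%N => //= -[//|n] _.
  by have := Fw n.+1 Logic.I; rewrite /F [nseq _ _]/= cylinder_cons size_nseq => -[].
apply: (@lt_le_trans _ _ e%:E); first by rewrite lte_fin.
rewrite -(cvg_lim _ cvgF)//; apply: lime_ge.
  by apply/cvg_ex; exists (P (\bigcap_n F n)).
by apply: nearW => n; rewrite /= word_probE word_prob_nseq_false lee_fin.
Qed.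

(** * Monopoly implies domination *)

(** From time [N] on, [white - b * tau] does not change: it is the number of white balls when [b] is
    [false], and minus the number of black balls when [b] is [true]. *)
Lemma constant_draws_white_prop b N k w :
  (forall n, (N <= n)%N -> I n w = b) ->
  white_prop sigma tau0 T0 I (N + k) w = b%:R +
    (white sigma T0 I N w - b%:R * tau sigma tau0 N) / tau sigma tau0 (N + k).
Proof.
move=> Ib; rewrite /white_prop; set t := tau _ _ (N + k).
have t0 : t != 0 by rewrite gt_eqF//; exact: tau_gt0 sigma_gt0 T0_bounds _.
suff -> : white sigma T0 I (N + k) w =
    white sigma T0 I N w + b%:R * (t - tau sigma tau0 N) by field.
rewrite /t {t t0}; elim: k => [|k IHk]; first by rewrite addn0 subrr mulr0 addr0.
have Ib1 : I (N + k).+1 w = b by apply: Ib; rewrite -addnS leq_addr.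
rewrite addnS tauS; rewrite [LHS]/= IHk Ib1; ring.
Qed.

Lemma constant_draws_cvg b w :
  (\sum_(1 <= n <oo) ((tau sigma tau0 n)^-1)%:E < +oo)%E ->
  (\forall n \near \oo, I n w = b) ->
  white_prop sigma tau0 T0 I n w @[n --> \oo] --> (b%:R : R).
Proof.
move=> sum_tau [N _ Ib].
pose c : R := white sigma T0 I N w - b%:R * tau sigma tau0 N.
have inv_tau_cvg0 : (tau sigma tau0 n)^-1 @[n --> \oo] --> (0 : R).
  apply: cvg0_nneseries_lty (nneseries_inv_tau_lty sigma_gt0 T0_bounds sum_tau).
  by move=> n; rewrite invr_ge0 ltW//; exact: tau_gt0 sigma_gt0 T0_bounds n.
have cvgb : b%:R + c * (tau sigma tau0 n)^-1 @[n --> \oo] --> (b%:R : R).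
  rewrite -[X in _ --> X]addr0 -[X in _ + X](mulr0 c).
  by apply: cvgD; [exact: cvg_cst|apply: cvgM => //; exact: cvg_cst].
apply: cvg_trans cvgb; apply: near_eq_cvg; exists N => // n /= Nn.
by rewrite -(subnKC Nn) (constant_draws_white_prop _ Ib).
Qed.

Lemma monopoly_le_domination (Theta : {RV P >-> R}) :
  (\sum_(1 <= n <oo) ((tau sigma tau0 n)^-1)%:E < +oo)%E ->
  {ae P, forall w, white_prop sigma tau0 T0 I n w @[n --> \oo] --> Theta w} ->
  (P (monopoly I) <= P (domination Theta))%E.
Proof.
move=> sum_tau [B [mB PB0 subB]].
have mD : measurable (domination Theta).
  by apply: measurableU; exact: (measurable_funPTI Theta (measurable_set1 _)).
rewrite -(measureU0 mD mB PB0); apply: le_measure; rewrite ?inE//.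
- exact: measurable_monopoly.
- exact: measurableU.
move=> w Mw; have [Bw|nBw] := pselect (B w); [by right|left].
have cvgw : white_prop sigma tau0 T0 I n w @[n --> \oo] --> Theta w.
  by apply: contrapT => ncvg; exact/nBw/subB.
have ThetaE b : (\forall n \near \oo, I n w = b) -> Theta w = b%:R.
  move=> Ib; have cvgb := constant_draws_cvg sum_tau Ib.
  exact: (cvg_unique (@norm_hausdorff _ _) cvgw cvgb).
by case: Mw => Ib; [left|right]; rewrite /= (ThetaE _ Ib).
Qed.

(** * Colour switches and almost sure monopoly *)

(** The two draws compared are those that follow a word of length [n]; the shift keeps [I 0] out. *)
Definition switch n : set Omega := [set w | I n.+1 w != I n.+2 w].

Lemma measurable_switch n : measurable (switch n).
Proof.
have -> : switch n =
    ([set w | I n.+1 w = true] `&` [set w | I n.+2 w = false]) `|`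
    ([set w | I n.+1 w = false] `&` [set w | I n.+2 w = true]).
  apply/seteqP; split => w; rewrite /switch /=.
    by case: (I n.+1 w); case: (I n.+2 w) => // _; [left|right].
  by case=> -[-> ->].
by apply: measurableU; apply: measurableI; exact: measurable_draw.
Qed.

Local Notation ratio n := (sigma n.+1 / tau sigma tau0 n.+1).

(* For [m = 0] the left-hand side is exact up to a factor [1 - r]; a step uses that
   [p (1 - p)] averages to [(1 - r ^+ 2) p (1 - p)] over the next draw. *)
Lemma measure_cylinder_switch_le m s :
  (P (cyl s `&` switch (size s + m)) <=
   (2 * word_prop s * (1 - word_prop s) *
    \prod_(size s <= i < size s + m) (1 - ratio i ^+ 2) * word_prob s)%:E)%E.
Proof.
have mS n : measurable (switch n) by exact: measurable_switch.
elim: m s => [|m IHm] s.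
  (* Two further draws [b], then [c], decide the switch: only the two words with [b != c]
     contribute. *)
  have sub b c : (P (cyl [:: c, b & s] `&` switch (size s)) <=
      (if b == c then 0 else word_prob [:: c, b & s])%:E)%E.
    have [bc|bc] := eqVneq b c.
      rewrite (_ : _ `&` _ = set0) ?measure0//; apply/seteqP; split => w //.
      by rewrite bc !cylinder_cons /switch /= => -[[[_ ->] ->]]; rewrite eqxx.
    rewrite -word_probE; apply: le_measure; rewrite ?inE//.
    - by apply: measurableI => //; exact: measurable_cylinder.
    - exact: measurable_cylinder.
  rewrite addn0 (measure_cylinder_split s (mS _)) big_geq//.
  rewrite (measure_cylinder_split (true :: s) (mS _)) (measure_cylinder_split (false :: s) (mS _)).
  apply: (le_trans (leeD (leeD (sub _ _) (sub _ _)) (leeD (sub _ _) (sub _ _)))).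
  rewrite /= -!EFinD lee_fin !add0r !addr0.
  rewrite !(word_prob_true, word_prob_false).
  rewrite !(word_prop_cons sigma_gt0 T0_bounds).
  have /andP[r0 r1] := reinforcement_ratio_bounds sigma_gt0 T0_bounds (size s).
  have /andP[p0 p1] := word_prop_bounds sigma_gt0 T0_bounds s.
  have q0 := word_prob_ge0 s.
  move: (ratio _) (word_prop s) (word_prob s) r0 r1 p0 p1 q0 => r p q r0 r1 p0 p1 q0.
  rewrite mulr1n mulr0n -subr_ge0.
  (* The slack in the bound is exactly [2 * r * p * (1 - p) * q]. *)
  rewrite [leRHS](_ : _ = 2 * (r * (p * ((1 - p) * q)))); last by ring.
  by rewrite !mulr_ge0// subr_ge0.
rewrite addnS (measure_cylinder_split _ (mS _)).
have := leeD (IHm (true :: s)) (IHm (false :: s)).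
rewrite /= !addSn => /le_trans; apply.
rewrite -EFinD lee_fin (big_ltn (_ : size s < (size s + m).+1)%N) ?ltnS ?leq_addr//.
rewrite word_prob_true word_prob_false !(word_prop_cons sigma_gt0 T0_bounds).
by rewrite le_eqVlt; apply/orP; left; apply/eqP; rewrite mulr1n mulr0n; ring.
Qed.
(** By contraposition: without a switch from [n] on, all draws from [n.+1] on have the same
    colour. *)
Lemma monopolyC_sub_lim_sup_switch : ~` monopoly I `<=` lim_sup_set switch.
Proof.
move=> w nM n _; apply: contrapT => noswitch; apply: nM.
have Iconst k : I (n + k).+1 w = I n.+1 w.
  elim: k => [|k IHk]; first by rewrite addn0.
  rewrite addnS -IHk; apply/eqP; rewrite eq_sym; apply: contrapT => /negP sw.
  by apply: noswitch; exists (n + k)%N => //=; exact: leq_addr.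
have Ieventually : \forall k \near \oo, I k w = I n.+1 w.
  by exists n.+1 => // -[//|k] /=; rewrite ltnS => nk; rewrite -(subnKC nk).
by case E : (I n.+1 w) Ieventually; [right|left].
Qed.

Lemma measure_switch_le m :
  (P (switch m) <= (2 * \prod_(0 <= i < m) (1 - ratio i ^+ 2))%:E)%E.
Proof.
have := measure_cylinder_switch_le m [::].
rewrite cylinder_nil setTI add0n word_prob_nil mulr1 => /le_trans; apply.
have /andP[p0 p1] := word_prop_bounds sigma_gt0 T0_bounds [::].
have prod0 : 0 <= \prod_(0 <= i < m) (1 - ratio i ^+ 2).
  apply: prodr_ge0 => i _; rewrite subr_ge0.
  by have /andP[r0 r1] := reinforcement_ratio_bounds sigma_gt0 T0_bounds i; exact: exprn_ile1.
rewrite lee_fin ler_wpM2r// -mulrA ler_piMr// mulr_ile1 ?subr_ge0//.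
by rewrite gerBl.
Qed.

Lemma monopoly_eq1 :
  (0 < limn_einf (fun n => (sigma n / tau sigma tau0 n)%:E))%E ->
  P (monopoly I) = 1%E.
Proof.
move=> /limn_einf_gt0_near[c c0 [N _ leN]].
(* Capping [c] at 1/2 ensures [0 < c' < 1], hence [0 < q < 1], as the geometric comparison
   requires. *)
pose c' := Num.min c 2^-1.
have c'0 : 0 < c' by rewrite lt_min c0 invr_gt0 ltr0n.
have c'1 : c' < 1 by rewrite gt_min invf_lt1 ?ltr1n ?orbT.
pose q := 1 - c' ^+ 2.
have q0 : 0 < q by rewrite subr_gt0 exprn_ilt1// ltW.
have q1 : q < 1 by rewrite gtrBl exprn_gt0.
have [|||K K0 leK] := @prod_le_expr R (fun i => 1 - ratio i ^+ 2) q q0.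
- move=> i.
  have /andP[r0 r1] := reinforcement_ratio_bounds sigma_gt0 T0_bounds i.
  by rewrite subr_ge0 exprn_ile1//= gerBl exprn_ge0.
- exists N => // i /= Ni.
  have c'r : c' <= ratio i.
    by rewrite (le_trans _ (leN i.+1 _)) ?ge_min ?lexx//= ltnW.
  by rewrite lerD2l lerN2 lerXn2r ?nnegrE ?(le_trans (ltW c'0) c'r)// ltW.
- exact: ltW.
have sum_switch : (\sum_(0 <= n <oo) P (switch n) < +oo)%E.
  apply: le_lt_trans (@nneseries_geometric_lty R (2 * K) q _ _).
  - apply: lee_nneseries => // n _; apply: le_trans (measure_switch_le n) _.
    by rewrite lee_fin -mulrA ler_pM2l.
  - by rewrite mulr_ge0.
  - by rewrite q0.
(* Borel-Cantelli: almost surely only finitely many switches occur. *)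
have lim0 := lim_sup_set_cvg0 measurable_switch sum_switch.
have mM := measurable_monopoly.
have mL : measurable (lim_sup_set switch).
  apply: bigcapT_measurable => n; apply: bigcup_measurable => k _.
  exact: measurable_switch.
have PMC0 : P (~` monopoly I) = 0%E.
  apply/eqP; rewrite eq_le measure_ge0 andbT -lim0; apply: le_measure; rewrite ?inE//.
  - exact: measurableC.
  - exact: monopolyC_sub_lim_sup_switch.
by rewrite -(setCK (monopoly I)) probability_setC ?PMC0 ?sube0//; exact: measurableC.
Qed.

End Urn.

Theorem theorem1p1 (d : measure_display) (Omega : measurableType d)
    (R : realType) (P : probability Omega R)
    (sigma : nat -> R) (sigma_gt0 : forall n, (1 <= n)%N -> 0 < sigma n)
    (tau0 T0 : nat) (T0_bounds : (1 <= T0 <= tau0 - 1)%N)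
    (I : nat -> {RV P >-> bool}) (urnI : polya_urn sigma tau0 T0 I)
    (Theta : {RV P >-> R})
    (cvgTheta : {ae P, forall w,
       white_prop sigma tau0 T0 I n w @[n --> \oo] --> Theta w})
    (sum_tau : (\sum_(1 <= n <oo) ((tau sigma tau0 n)^-1)%:E < +oo)%E) :
  ((0 < P (monopoly I)) /\ (P (monopoly I) <= P (domination Theta)) /\
   (0 < limn_einf (fun n => (sigma n / tau sigma tau0 n)%:E) ->
    P (monopoly I) = 1 /\ P (domination Theta) = 1))%E.
Proof.
have M_le_D := monopoly_le_domination sigma_gt0 T0_bounds sum_tau cvgTheta.
split; first exact: monopoly_gt0 sigma_gt0 T0_bounds urnI sum_tau.
split=> // /(monopoly_eq1 sigma_gt0 T0_bounds urnI) PM1; split=> //.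
apply/eqP; rewrite eq_le -{2}PM1 M_le_D andbT probability_le1//.
by apply: measurableU; exact: (measurable_funPTI Theta (measurable_set1 _)).
Qed.
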